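(* Let $(M,d)$ be a nonempty complete metric space. Let $U,V:M\to M$ be weakly compatible mappings with $V(M)\subseteq U(M)$. Suppose that $\varphi:(0,\infty)\to(1,\infty)$ is a non-decreasing function and that there exists a constant $\eta>1$ such that, for all $x,z\in M$ with $Vx\neq Vz$, one has $Ux\neq Uz$ and $$\varphi(d(Ux,Uz))\geq[\varphi(d(Vx,Vz))]^{\eta}.$$ If one of the subspaces $U(M)$ or $V(M)$ is complete, then $U$ and $V$ have a unique common fixed point in $M$.
   Context: A point $z\in M$ is a coincidence point of self mappings $U$ and $V$ of $M$ if $Uz=Vz$. Two self mappings $U$ and $V$ of a metric space $(M,d)$ are weakly compatible if they commute at every coincidence point, i.e. $UVz=VUz$ for every $z\in M$ with $Uz=Vz$. A common fixed point of $U$ and $V$ is a point $p\in M$ with $Up=Vp=p$. *)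

(* Defs.v *)
From HB Require Import structures.
From mathcomp Require Import all_boot all_order all_algebra.
From mathcomp Require Import all_classical all_reals all_analysis.

Set Implicit Arguments.
Unset Strict Implicit.
Unset Printing Implicit Defensive.

Local Open Scope classical_set_scope.

(* The completeness axiom of [completeType], as a predicate. It does not ask
   for a distinguished point, so it applies to an arbitrary subspace
   [set_type A] (with the uniformity induced from the ambient space); this is
   why convergence is written [exists p, F --> p] and not [cvg F], which is
   defined through [lim] and needs a pointed type. *)
Definition complete_space (T : uniformType) : Prop :=
  forall F : set_system T, ProperFilter F -> cauchy F -> exists p : T, F --> p.

Lemma completeType_complete_space (T : completeType) : complete_space T.
Proof. by move=> F FF cF; exists (lim F); exact: cauchy_cvg. Qed.

Definition coincidence_point (M : Type) (U V : M -> M) (z : M) : Prop :=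
  U z = V z.

Definition weakly_compatible (M : Type) (U V : M -> M) : Prop :=
  forall z, coincidence_point U V z -> U (V z) = V (U z).

Definition common_fixed_point (M : Type) (U V : M -> M) (p : M) : Prop :=
  U p = p /\ V p = p.

(* Main.v *)
Require Import Defs.
From HB Require Import structures.
From mathcomp Require Import all_boot all_order all_algebra.
From mathcomp Require Import all_classical all_reals all_analysis.
From mathcomp Require Import lra.

Import Order.TTheory GRing.Theory Num.Theory.
Local Open Scope classical_set_scope.
Local Open Scope ring_scope.

(** Put [psi := ln \o phi]. The hypothesis on [phi] becomes linear: [psi] is
    positive and nondecreasing on the positive reals, and
    [eta * psi (d (V x) (V z)) <= psi (d (U x) (U z))] whenever [V x <> V z].
    Monotonicity turns this into [d (V x) (V z) < d (U x) (U z)], which gives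
    uniqueness, and fixedness once a coincidence point is known.

    For existence, choose [x_ n] with [U (x_ n.+1) = V (x_ n)], which is
    possible because [V] maps into the range of [U], and let
    [y n := V (x_ n)]. No continuity of [phi] is assumed, so one cannot pass to
    the limit inside [phi]. The substitute is [ratio_gap]: multiplying the
    infimum of a set of reals bounded away from 0 by [eta > 1] moves it up, so
    some element [a] of the set is so close to the infimum that no [b] with
    [eta * b <= a] remains in the set. It is used twice:
    - for the values of [psi] along the steps [d (y n) (y n.+1)], to see that
      the steps cannot stay above a positive number ([gauge_steps_small]);
    - for the values of [psi] to the right of [e], to get a Meir-Keeler
      property: distances slightly above [e] are sent to distances at most [e]
      ([gauge_meir_keeler]).
    Together these make [y] a Cauchy sequence ([meir_keeler_cauchy]). As [y]
    runs in the range of [V], hence in that of [U], completeness of either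
    range puts its limit in the range of [U], say at [U p]. Since [V] shrinks
    distances relative to [U], [y] also tends to [V p]; so [p] is a coincidence
    point, and weak compatibility makes [U p] a common fixed point. *)

(** * Gauges on the positive reals *)

(** An element [a] of [S] below [eta * inf S] works: [eta * b <= a] puts [b]
    strictly below [inf S]. *)
Lemma ratio_gap (R : realType) (eta m : R) (S : set R) :
  1 < eta -> 0 < m -> S !=set0 -> lbound S m ->
  exists2 a, S a & forall b, eta * b <= a -> ~ S b.
Proof.
move=> eta1 m0 S0 Sm.
have infS : has_inf S by split => //; exists m.
have c0 : 0 < inf S by apply: (lt_le_trans m0); apply: lb_le_inf.
have e0 : 0 < eta * inf S - inf S by rewrite subr_gt0 ltr_pMl.
have [a Sa ac] := inf_adherent e0 infS.
exists a => // b ba Sb.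
have cb : inf S <= b by apply: ge_inf => //; exists m.
have : eta * inf S <= eta * b by rewrite ler_pM2l//; lra.
by lra.
Qed.

Definition gauge (R : realType) (psi : R -> R) :=
  (forall t, 0 < t -> 0 < psi t) /\
  (forall s t, 0 < s -> s <= t -> psi s <= psi t).

Lemma ln_gauge (R : realType) (phi : R -> R) :
  (forall t, 0 < t -> 1 < phi t) ->
  (forall s t, 0 < s -> s <= t -> phi s <= phi t) ->
  gauge R (fun t => ln (phi t)).
Proof.
move=> phi1 phi_nd; split => [t t0|s t s0 st]; first exact/ln_gt0/phi1.
have t0 := lt_le_trans s0 st.
by rewrite ler_ln ?posrE ?(lt_trans ltr01) ?phi1// phi_nd.
Qed.

Lemma gauge_lt (R : realType) (psi : R -> R) (eta s t : R) :
  gauge R psi -> 1 < eta -> 0 < s -> 0 < t ->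
  eta * psi s <= psi t -> s < t.
Proof.
move=> [psi0 psi_nd] eta1 s0 t0 st; rewrite ltNge; apply/negP => ts.
have := psi_nd _ _ t0 ts; have := psi0 _ s0.
by rewrite -(ltr_pM2r (psi0 _ s0)) mul1r in eta1; lra.
Qed.

(** The gap at the right limit of [psi] in [e]: this value exceeds [psi e] when
    [psi] jumps, which is why the conclusion is [s <= e] and not [s < e]. *)
Lemma gauge_meir_keeler (R : realType) (psi : R -> R) (eta e : R) :
  gauge R psi -> 1 < eta -> 0 < e ->
  exists2 t, e < t & forall r s, 0 < r -> r <= t ->
    eta * psi s <= psi r -> s <= e.
Proof.
move=> [psi0 psi_nd] eta1 e0.
have [| |_ [t et <-] gap] := @ratio_gap R eta (psi e) (psi @` [set t | e < t])
  eta1 (psi0 _ e0).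
- by exists (psi (e + 1)); exists (e + 1) => //=; lra.
- by move=> _ [t /= et <-]; apply: psi_nd => //; exact: ltW.
exists t => // r s r0 rt sr; rewrite leNgt; apply/negP => es.
by apply: (gap (psi s)); [exact: le_trans sr (psi_nd _ _ r0 rt)|exists s].
Qed.

Lemma gauge_steps_small (R : realType) (psi : R -> R) (eta e : R)
    (d : nat -> R) :
  gauge R psi -> 1 < eta -> 0 < e ->
  (forall n, 0 < d n.+1 -> eta * psi (d n.+1) <= psi (d n)) ->
  exists n, d n < e.
Proof.
move=> [psi0 psi_nd] eta1 e0 dS; apply: contrapT => /forallNP ed.
have {}ed n : e <= d n by rewrite leNgt; apply/negP/ed.
have [| |_ [n _ <-] gap] := @ratio_gap R eta (psi e) (range (psi \o d))
  eta1 (psi0 _ e0).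
- by exists (psi (d 0)); exists 0%N.
- by move=> _ [n _ <-]; apply: psi_nd.
apply: (gap (psi (d n.+1))); last by exists n.+1.
by apply: dS; exact: lt_le_trans (ed _).
Qed.

(** * Sequences in a metric space *)

(** The entourages of [set_type A] are the traces of those of [M], so [y],
    lifted to the subspace, is a Cauchy filter there; the inclusion is
    continuous and carries its limit back to [M]. *)
Lemma complete_subspace_cvg (R : realType) (M : metricType R) (A : set M)
    (y : nat -> M) :
  complete_space (set_type A) -> (forall n, A (y n)) ->
  (forall e : R, 0 < e -> exists N : nat, forall m n : nat,
     (N <= m)%N -> (N <= n)%N -> mdist (y m) (y n) < e) ->
  exists2 q, A q & y @ \oo --> q.
Proof.
move=> Acomplete yA y_cauchy.
pose s n : set_type A := exist _ (y n) (mem_set (yA n)).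
have s_cauchy : cauchy (s @ \oo).
  move=> E [B]; rewrite -entourage_ballE => -[e /= e0 eB] BE.
  have [N Ny] := y_cauchy _ e0.
  exists (s @` [set n | (N <= n)%N], s @` [set n | (N <= n)%N]) => /=.
    by split; exists N => // n /= Nn; exists n.
  move=> [_ _] /= [[m Nm <-] [n Nn <-]]; apply: BE; apply: eB => /=.
  by rewrite ballEmdist/=; exact: Ny.
have [q sq] := Acomplete _ _ s_cauchy.
exists (val q); first exact: set_valP.
have cval : continuous (val : set_type A -> M) by exact: initial_continuous.
exact: (cvg_comp _ _ sq (cval q)).
Qed.

(** Fix [e], take [t > e] from the Meir-Keeler condition, and start where the
    steps are below [t - e]. If [y n.+1] and [y (n.+1 + k)] are within [e], then
    [y n] and [y (n.+1 + k)] are within [t], so their successors are within [e]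
    again: the bound [e] propagates along [k]. *)
Lemma meir_keeler_cauchy (R : realType) (M : metricType R) (y : nat -> M) :
  (forall e : R, 0 < e -> exists N : nat, forall n : nat,
     (N <= n)%N -> mdist (y n) (y n.+1) < e) ->
  (forall e : R, 0 < e -> exists2 t, e < t & forall m n : nat,
     mdist (y m) (y n) <= t -> mdist (y m.+1) (y n.+1) <= e) ->
  forall e : R, 0 < e -> exists N : nat, forall m n : nat,
     (N <= m)%N -> (N <= n)%N -> mdist (y m) (y n) < e.
Proof.
move=> steps mk e e0; have e20 : 0 < e / 2 by lra.
have [t et tmk] := mk _ e20.
have [|N Nsteps] := steps (t - e / 2); first by lra.
have near n k : (N <= n)%N -> mdist (y n.+1) (y (n.+1 + k)%N) <= e / 2.
  move=> Nn; elim: k => [|k IHk]; first by rewrite addn0 mdistxx ltW.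
  rewrite addnS; apply: tmk.
  have := metric_triangle (y n) (y n.+1) (y (n.+1 + k)%N).
  by have := Nsteps _ Nn; lra.
have lt m n : (N < m)%N -> (m <= n)%N -> mdist (y m) (y n) < e.
  case: m => // m Nm /subnKC <-.
  by have := near m (n - m.+1)%N Nm; lra.
exists N.+1 => m n Nm Nn; have [mn|/ltnW nm] := leqP m n; first exact: lt.
by rewrite metric_sym; exact: lt.
Qed.

(** * Contractions of one map relative to another *)

Definition gauge_contraction (R : realType) (M : metricType R)
    (psi : R -> R) (eta : R) (U V : M -> M) :=
  forall x z, V x <> V z -> U x <> U z /\
    eta * psi (mdist (V x) (V z)) <= psi (mdist (U x) (U z)).

Section gauge_contraction.
Context (R : realType) (M : metricType R) (psi : R -> R) (eta : R).
Context (U V : M -> M).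
Hypothesis psi_gauge : gauge R psi.
Hypothesis eta_gt1 : 1 < eta.
Hypothesis UV : gauge_contraction R M psi eta U V.

Lemma contraction_lt x z : V x <> V z ->
  mdist (V x) (V z) < mdist (U x) (U z).
Proof.
move=> Vxz; have [Uxz le_psi] := UV _ _ Vxz.
by apply: (gauge_lt _ _ _ _ _ psi_gauge eta_gt1 _ _ le_psi);
  rewrite mdist_gt0; apply/eqP.
Qed.

Lemma contraction_le x z : mdist (V x) (V z) <= mdist (U x) (U z).
Proof.
have [->|/eqP Vxz] := eqVneq (V x) (V z); first by rewrite mdistxx mdist_ge0.
exact/ltW/contraction_lt.
Qed.

Lemma contraction_inj x z : U x = V x -> U z = V z -> V x = V z.
Proof.
move=> Ux Uz; apply: contrapT => /contraction_lt.
by rewrite Ux Uz ltxx.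
Qed.

Lemma contraction_orbit_cauchy (x_ : nat -> M) :
  (forall n, U (x_ n.+1) = V (x_ n)) ->
  forall e : R, 0 < e -> exists N : nat, forall m n : nat,
    (N <= m)%N -> (N <= n)%N -> mdist (V (x_ m)) (V (x_ n)) < e.
Proof.
move=> Ux; apply: (meir_keeler_cauchy _ _ (fun n => V (x_ n))) => e e0.
- have [|N Ne] := gauge_steps_small _ _ _ _
    (fun n => mdist (V (x_ n)) (V (x_ n.+1))) psi_gauge eta_gt1 e0.
    move=> n; rewrite mdist_gt0 => /eqP /UV[_].
    by rewrite !Ux.
  exists N => n /subnKC <-; elim: (n - N)%N => [|k IHk]; first by rewrite addn0.
  rewrite addnS; apply: le_lt_trans IHk.
  by have := contraction_le (x_ (N + k).+1) (x_ (N + k).+2); rewrite !Ux.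
- have [t et tmk] := gauge_meir_keeler _ _ _ _ psi_gauge eta_gt1 e0.
  exists t => // m n le_t.
  have [->|/eqP /UV] := eqVneq (V (x_ m.+1)) (V (x_ n.+1)).
    by rewrite mdistxx ltW.
  rewrite !Ux => -[/eqP ne_V le_psi].
  by apply: tmk le_t le_psi; rewrite mdist_gt0.
Qed.

Lemma contraction_coincidence (A : set M) :
  [set: M] !=set0 -> range V `<=` A -> A `<=` range U ->
  complete_space (set_type A) -> exists p, U p = V p.
Proof.
move=> [x0 _] VA AU Acomplete.
have /choice[next Unext] x : exists x', U x' = V x.
  by have [|x' _ <-] := AU (V x); [apply: VA; exists x|exists x'].
pose x_ n := iter n next x0.
have Ux n : U (x_ n.+1) = V (x_ n) by exact: Unext.
have [||q /AU[p _ <-] yUp] := complete_subspace_cvg _ _ A (fun n => V (x_ n))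
  Acomplete.
- by move=> n; apply: VA; exists (x_ n).
- exact: contraction_orbit_cauchy.
exists p; apply: (cvg_unique (@metric_hausdorff _ M) yUp).
apply/metricType_numDomainType.cvgrPdist_lt => e e0.
have /metricType_numDomainType.cvgrPdist_lt /(_ e e0)[N _ NUp] := yUp.
exists N.+1 => // -[//|n] /= Nn.
by apply: (le_lt_trans (contraction_le _ _)); rewrite Ux; exact: NUp.
Qed.

(** At a coincidence point [p], weak compatibility makes [U p] another
    coincidence point, and two coincidence points have the same value. *)
Lemma coincidence_common_fixed_point p :
  weakly_compatible U V -> U p = V p -> common_fixed_point U V (U p).
Proof.
move=> wc Up; have UUp : U (U p) = V (U p) by rewrite {1}Up; exact: wc.
have VUp : V (U p) = U p by rewrite Up; apply: contraction_inj; rewrite -?Up.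
by split; rewrite ?UUp.
Qed.

End gauge_contraction.

Theorem theorem2p3 (R : realType) (M : metricType R)
  (M_nonempty : [set: M] !=set0) (M_complete : complete_space M)
  (U V : M -> M)
  (UV_compat : weakly_compatible U V)
  (VU_range : range V `<=` range U)
  (phi : R -> R)
  (phi_gt1 : forall t : R, 0 < t -> 1 < phi t)
  (phi_nondecreasing : forall s t : R, 0 < s -> s <= t -> phi s <= phi t)
  (eta : R) (eta_gt1 : 1 < eta)
  (contractive : forall x z : M, V x <> V z ->
     U x <> U z /\
     phi (mdist (U x) (U z)) >= phi (mdist (V x) (V z)) `^ eta)
  (UV_complete : complete_space (set_type (range U)) \/
                 complete_space (set_type (range V))) :
  exists! p : M, common_fixed_point U V p.
Proof.
have psi_gauge := ln_gauge _ _ phi_gt1 phi_nondecreasing.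
have UV : gauge_contraction R M (fun t => ln (phi t)) eta U V.
  move=> x z Vxz; have [Uxz le_phi] := contractive _ _ Vxz; split => //.
  have phi0 a b : a <> b :> M -> 0 < phi (mdist a b).
    by move=> ab; rewrite (lt_trans ltr01)// phi_gt1// mdist_gt0; apply/eqP.
  by rewrite -ln_powR ler_ln ?posrE ?powR_gt0 ?phi0.
have [p Up] : exists p, U p = V p.
  case: UV_complete => complete.
  - exact: (contraction_coincidence _ _ _ _ _ _ psi_gauge eta_gt1 UV (range U)).
  - exact: (contraction_coincidence _ _ _ _ _ _ psi_gauge eta_gt1 UV (range V)).
have [UUp VUp] := coincidence_common_fixed_point _ _ _ _ _ _
  psi_gauge eta_gt1 UV _ UV_compat Up.
exists (U p); split => // q [Uq Vq].
rewrite -VUp -[RHS]Vq.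
by apply: (contraction_inj _ _ _ _ _ _ psi_gauge eta_gt1 UV); congruence.
Qed.
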